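(* Let $\mathcal{B}=(B_t)_{t\in G}$ be a Fell bundle over a discrete group $G$. The map $I\mapsto\mathcal{I}=(I_t)_{t\in G}$, where $I_t=IB_t$, is an isomorphism from the lattice of $\mathcal{B}$-invariant ideals of $B_e$ onto the lattice of ideals of $\mathcal{B}$. Its inverse is given by $\mathcal{I}\mapsto\mathcal{I}\cap B_e$.
   Context: Ideals of $C^*$-algebras are closed and two-sided. For subsets $X_i\subseteq B_{t_i}$ of fibers, $X_1\cdots X_n$ denotes the closed linear span of the products $x_1\cdots x_n$ with $x_i\in X_i$; $X^*=\{x^*:x\in X\}$. A subset $\mathcal{J}\subseteq\mathcal{B}$ is an ideal of $\mathcal{B}$ if it is a Fell bundle over $G$ with the inherited structure (fibers $J_t=\mathcal J\cap B_t$) and $\mathcal{J}\mathcal{B}=\mathcal{J}=\mathcal{B}\mathcal{J}$. An ideal $I$ in $B_e$ is $\mathcal{B}$-invariant if $B_tIB_t^*\subseteq I$ for all $t\in G$. Both families are ordered by inclusion. *)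

(* Defs.v *)
From mathcomp Require Export all_boot all_order all_algebra.
From mathcomp Require Export complex.
From mathcomp Require Export boolp classical_sets functions reals topology.
From mathcomp Require Export normedtype.

Set Implicit Arguments.
Unset Strict Implicit.
Unset Printing Implicit Defensive.

Import GRing.Theory Num.Theory.
Import numFieldNormedType.Exports.

Local Open Scope classical_set_scope.
Local Open Scope ring_scope.

(* The multiplication B_s x B_t -> B_st and the involution B_t -> B_t^-1 are
   indexed by a proof that the target index is s * t, resp. t^-1, instead of
   targeting B (s * t) and B t^-1 literally.  Such a proof is unique (a
   groupType has decidable equality), so this carries no extra data; it only
   lets the axioms be equations inside one fiber, without transports.
   An element of B_1 is positive iff it is of the form c^* c with c in B_1;
   this is the meaning of positivity in fstar_mul_ge0. *)
Record fell_bundle (R : realType) (G : groupType) := FellBundle {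
  fbr :> G -> completeNormedModType R[i];
  fmul : forall s t u : G, (s * t)%g = u -> fbr s -> fbr t -> fbr u;
  fstar : forall s t : G, (s^-1)%g = t -> fbr s -> fbr t;
  fmul_linearl : forall (s t u : G) (e : (s * t)%g = u) (b : fbr t),
    linear (fun a : fbr s => fmul e a b);
  fmul_linearr : forall (s t u : G) (e : (s * t)%g = u) (a : fbr s),
    linear (fun b : fbr t => fmul e a b);
  fmulA : forall (s t u st tu stu : G)
      (e1 : (s * t)%g = st) (e2 : (st * u)%g = stu)
      (e3 : (t * u)%g = tu) (e4 : (s * tu)%g = stu)
      (a : fbr s) (b : fbr t) (c : fbr u),
    fmul e2 (fmul e1 a b) c = fmul e4 a (fmul e3 b c);
  fmul_norm : forall (s t u : G) (e : (s * t)%g = u) (a : fbr s) (b : fbr t),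
    `|fmul e a b| <= `|a| * `|b|;
  fstar_semilinear : forall (s t : G) (e : (s^-1)%g = t) (k : R[i])
      (a b : fbr s),
    fstar e (k *: a + b) = k^* *: fstar e a + fstar e b;
  fstarK : forall (s t : G) (e : (s^-1)%g = t) (e' : (t^-1)%g = s)
      (a : fbr s),
    fstar e' (fstar e a) = a;
  fstarM : forall (s t u s' t' u' : G) (e : (s * t)%g = u)
      (es : (s^-1)%g = s') (et : (t^-1)%g = t') (eu : (u^-1)%g = u')
      (e' : (t' * s')%g = u') (a : fbr s) (b : fbr t),
    fstar eu (fmul e a b) = fmul e' (fstar et b) (fstar es a);
  fstar_norm : forall (s t : G) (e : (s^-1)%g = t) (a : fbr s),
    `|fstar e a| = `|a|;
  fstar_mul_norm : forall (t : G) (a : fbr t),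
    `|fmul (mulVg t) (fstar erefl a) a| = `|a| ^+ 2;
  fstar_mul_ge0 : forall (t : G) (a : fbr t), exists c : fbr 1%g,
    fmul (mulVg t) (fstar erefl a) a = fmul (mulg1 1%g) (fstar (invg1 G) c) c
}.

Arguments fmul {R G} f {s t u} e a b.
Arguments fstar {R G} f {s t} e a.

Definition closed_subspace (R : realType) (V : normedModType R[i])
    (X : set V) : Prop :=
  closed X /\ submod_closed [in X].

Definition linear_span (R : realType) (V : normedModType R[i])
    (X : set V) : set V :=
  [set y | exists n (k : 'I_n -> R[i]) (x : 'I_n -> V),
     (forall i, X (x i)) /\ y = \sum_(i < n) k i *: x i].

Definition closed_span (R : realType) (V : normedModType R[i])
    (X : set V) : set V :=
  closure (linear_span X).

Section FellBundleSets.
Context {R : realType} {G : groupType} (B : fell_bundle R G).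

Definition prod2 (s t u : G) (e : (s * t)%g = u)
    (X : set (B s)) (Y : set (B t)) : set (B u) :=
  closed_span [set z | exists x y, [/\ X x, Y y & z = fmul B e x y]].

Definition prod3 (s t u st stu : G)
    (e1 : (s * t)%g = st) (e2 : (st * u)%g = stu)
    (X : set (B s)) (Y : set (B t)) (Z : set (B u)) : set (B stu) :=
  closed_span [set w | exists x y z,
    [/\ X x, Y y, Z z & w = fmul B e2 (fmul B e1 x y) z]].

Definition star_set (t : G) (X : set (B t)) : set (B (t^-1)%g) :=
  fstar B erefl @` X.

Definition ideal_unit_fiber (I : set (B 1%g)) : Prop :=
  closed_subspace I /\
  forall x b : B 1%g, I x ->
    I (fmul B (mulg1 1%g) x b) /\ I (fmul B (mulg1 1%g) b x).

Lemma conj_index (t : G) : (t * 1 * t^-1)%g = 1%g.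
Proof. by rewrite mulg1 mulgV. Qed.

Definition invariant_ideal (I : set (B 1%g)) : Prop :=
  ideal_unit_fiber I /\
  forall t : G,
    prod3 erefl (conj_index t) [set: B t] I (star_set [set: B t]) `<=` I.

(* The bundle as a set is the disjoint union of its fibers. *)
Definition total : Type := {t : G & B t}.

Definition in_total (t : G) (b : B t) : total := existT (fun s => B s : Type) t b.

Definition set_fiber (J : set total) (t : G) : set (B t) :=
  [set b | J (in_total b)].
Arguments set_fiber J t : clear implicits.

Definition set_of_fibers (X : forall t : G, set (B t)) : set total :=
  [set z | X (projT1 z) (projT2 z)].

(* All remaining Fell bundle axioms restrict to subsets.  Positivity does not
   restrict formally, since the square root has to be taken in the unit fiber
   of J. *)
Definition fell_subbundle (J : set total) : Prop :=
  [/\ forall t : G, closed_subspace (set_fiber J t),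
      forall (s t u : G) (e : (s * t)%g = u) (a : B s) (b : B t),
        set_fiber J s a -> set_fiber J t b -> set_fiber J u (fmul B e a b),
      forall (s t : G) (e : (s^-1)%g = t) (a : B s),
        set_fiber J s a -> set_fiber J t (fstar B e a)
    & forall (t : G) (a : B t), set_fiber J t a ->
        exists2 c : B 1%g, set_fiber J 1%g c &
          fmul B (mulVg t) (fstar B erefl a) a =
          fmul B (mulg1 1%g) (fstar B (invg1 G) c) c].

(* The product of subsets of the bundle: its fiber at u is the closed linear
   span in B_u of all products x y with x in J_s, y in K_t and s t = u. *)
Definition bundle_prod (J K : set total) : set total :=
  set_of_fibers (fun u => closed_span
    [set z | exists s t (e : (s * t)%g = u) (x : B s) (y : B t),
       [/\ set_fiber J s x, set_fiber K t y & z = fmul B e x y]]).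

Definition bundle_ideal (J : set total) : Prop :=
  [/\ fell_subbundle J, bundle_prod J setT = J & bundle_prod setT J = J].

Definition induced (I : set (B 1%g)) : set total :=
  set_of_fibers (fun t => prod2 (mul1g t) I [set: B t]).

End FellBundleSets.

Arguments set_fiber {R G B} J t.
Arguments invariant_ideal {R G} B I.
Arguments bundle_ideal {R G} B J.
Arguments induced {R G} B I.

Section FamiliesOfSets.
Context {T U : Type}.

Definition is_meet (F : set (set T)) (X Y M : set T) : Prop :=
  [/\ F M, M `<=` X, M `<=` Y &
      forall N, F N -> N `<=` X -> N `<=` Y -> N `<=` M].

Definition is_join (F : set (set T)) (X Y M : set T) : Prop :=
  [/\ F M, X `<=` M, Y `<=` M &
      forall N, F N -> X `<=` N -> Y `<=` N -> M `<=` N].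

Definition is_lattice (F : set (set T)) : Prop :=
  forall X Y, F X -> F Y ->
    (exists M, is_meet F X Y M) /\ (exists M, is_join F X Y M).

End FamiliesOfSets.

Definition lattice_isomorphism (T U : Type) (F : set (set T))
    (F' : set (set U)) (f : set T -> set U) : Prop :=
  [/\ set_bij F F' f,
      forall X Y, F X -> F Y -> (X `<=` Y <-> f X `<=` f Y),
      forall X Y M, F X -> F Y -> is_meet F X Y M ->
        is_meet F' (f X) (f Y) (f M)
    & forall X Y M, F X -> F Y -> is_join F X Y M ->
        is_join F' (f X) (f Y) (f M)].

(* Main.v *)
From HB Require Import structures.
Require Import Defs.
From mathcomp Require Import ring lra.

Set Implicit Arguments.
Unset Strict Implicit.
Unset Printing Implicit Defensive.

Import Order.TTheory GRing.Theory Num.Theory.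
Import numFieldNormedType.Exports.

Local Open Scope classical_set_scope.
Local Open Scope ring_scope.

(** Everything rests on one approximation fact: every y in B_t is a limit of
    elements (y y^* ) v with v in B_t (approx_factor).  It replaces approximate
    units and functional calculus throughout.

    Granting it, let I be an ideal of B_1.  If y y^* lies in I then y lies in
    the closed span of I B_t; conversely the set of y with y b in I for every b
    in B_{t^-1} is closed and contains I B_t.  Hence that set is exactly I_t
    (inducedP), and in particular I_1 = I; the same fact applied to x^* shows
    that I is self-adjoint.  Invariance of I gives the mirror description: y is
    in I_t iff b y is in I for every b in B_{t^-1} (inducedP_left).  The two
    descriptions make closure under multiplication on both sides and under the
    involution immediate, so (I_t) is an ideal of the bundle.  In the other
    direction, if J is an ideal of the bundle and y is in J_t, then y y^* is in
    J_1, so y is in the closed span of J_1 B_t (induced_unit_fiber).  The two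
    maps are therefore inverse to each other; both preserve inclusion, hence
    meets and joins, and invariant ideals form a lattice because they are
    stable under arbitrary intersections.

    The approximation fact is proved by elementary means.  Put h = y y^* and let
    T be left multiplication on B_t by a small positive multiple of h; it is
    symmetric for the B_1-valued inner product <z, w> = z^* w.  The crucial
    estimate is that 1 - T^2 is a contraction (act_le_subX2).  Heuristically,
    T + i sqrt(1 - T^2) and -T + i sqrt(1 - T^2) are isometries, so their
    half-sum up to the scalar i, sqrt(1 - T^2), is a contraction, and so is its
    square; here the square root is replaced by polynomials in T approximating
    it, which avoids limits of operators.  The Cesaro means
    r_n = (1 + S + ... + S^n) / (n + 1) of S = 1 - T^2 then satisfy |r_n| <= 1
    and |T^2 r_n| <= 2 / (n + 1), whence T r_n -> 0 in norm
    (vanishing_factor).  Since |r_n y|^4 = |<r_n^2 y, h r_n^2 y>| by the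
    C*-identity, r_n y -> 0; and as r_n is 1 minus a multiple of T,
    y - r_n y is of the form h v. *)

(** * Real-valued norms *)

Section RealNorm.
Context {R : realType}.
Implicit Types V : normedModType R[i].

(** The norms here take values in [R[i]], whose order is partial; the
    estimates are carried out in [R], where the order is total. *)
Definition rnorm V (x : V) : R := complex.Re `|x|.

Lemma rnormE V (x : V) : `|x| = (rnorm x)%:C%C.
Proof. by rewrite [RHS]RRe_real // ger0_real. Qed.

Lemma rnorm_ge0 V (x : V) : 0 <= rnorm x.
Proof. by rewrite -ler0c -rnormE. Qed.

Lemma rnormD V (x y : V) : rnorm (x + y) <= rnorm x + rnorm y.
Proof. by rewrite -lecR rmorphD /= -!rnormE ler_normD. Qed.

Lemma rnormN V (x : V) : rnorm (- x) = rnorm x.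
Proof. by rewrite /rnorm normrN. Qed.

Lemma rnorm0 V : rnorm (0 : V) = 0.
Proof. by rewrite /rnorm normr0. Qed.

Lemma rnormZ V (k : R) (x : V) : rnorm (k%:C%C *: x) = `|k| * rnorm x.
Proof.
apply: complexI; rewrite rmorphM /= -!rnormE normrZ; congr (_ * _).
by rewrite normc_def /= expr0n addr0 sqrtr_sqr.
Qed.

Lemma rnormZi V (x : V) : rnorm ('i *: x) = rnorm x.
Proof. by rewrite /rnorm normrZ normCi mul1r. Qed.

Lemma conj_real (k : R) : (k%:C%C)^* = k%:C%C :> R[i].
Proof. by apply/CrealP; apply/complex_realP; exists k. Qed.

End RealNorm.

(** * Polynomials in a symmetric operator *)

(** [ip] is an abstract vector-valued inner product: positivity enters only
    through the identity |<x, x>| = |x|^2. *)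
Section SymmetricOperator.
Context {R : realType} {V W : normedModType R[i]}.
Context (T : {linear V -> V}) (ip : V -> V -> W).
Local Notation C := R[i].

Context (ipDl : forall x y z, ip (x + y) z = ip x z + ip y z).
Context (ipDr : forall x y z, ip x (y + z) = ip x y + ip x z).
Context (ipZl : forall (k : C) x y, ip (k *: x) y = k^* *: ip x y).
Context (ipZr : forall (k : C) x y, ip x (k *: y) = k *: ip x y).
Context (ip_le : forall x y, rnorm (ip x y) <= rnorm x * rnorm y).
Context (ip_norm : forall x, rnorm (ip x x) = rnorm x ^+ 2).
Context (T_half : forall x, rnorm (T x) <= 2^-1 * rnorm x).
Context (T_sym : forall x y, ip (T x) y = ip x (T y)).

(** The value p(T) x.  Real coefficients make every p(T) symmetric, and working
    with polynomials gives commutation of all the operators involved. *)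
Definition act (p : {poly R}) (x : V) : V :=
  \sum_(i < size p) (p`_i)%:C%C *: iter i T x.

Lemma act_widen n (p : {poly R}) x : (size p <= n)%N ->
  act p x = \sum_(i < n) (p`_i)%:C%C *: iter i T x.
Proof.
move=> le_pn; rewrite /act (big_ord_widen n (fun i => (p`_i)%:C%C *: iter i T x)) //.
rewrite big_mkcond; apply: eq_bigr => i _; case: ltnP => // le_pi.
by rewrite nth_default // rmorph0 scale0r.
Qed.

Lemma actD p q x : act (p + q) x = act p x + act q x.
Proof.
rewrite (act_widen (n := maxn (size p) (size q)) x (size_polyD _ _)).
rewrite (act_widen (p := p) x (leq_maxl _ (size q))).
rewrite (act_widen (p := q) x (leq_maxr (size p) _)) -big_split.
by apply: eq_bigr => i _; rewrite coefD rmorphD scalerDl.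
Qed.

Lemma actZ k p x : act (k *: p) x = k%:C%C *: act p x.
Proof.
rewrite (act_widen (n := size p)) ?size_scale_leq // scaler_sumr.
by apply: eq_bigr => i _; rewrite coefZ rmorphM scalerA.
Qed.

Lemma actN p x : act (- p) x = - act p x.
Proof. by rewrite -scaleN1r actZ rmorphN rmorph1 scaleN1r. Qed.

Lemma actB p q x : act (p - q) x = act p x - act q x.
Proof. by rewrite actD actN. Qed.

Lemma act1 x : act 1 x = x.
Proof. by rewrite /act size_poly1 big_ord1 coef1 rmorph1 scale1r. Qed.

Lemma actXM p x : act ('X * p) x = T (act p x).
Proof.
rewrite (act_widen (n := (size p).+1)); last first.
  by rewrite (leq_trans (size_polyMleq _ _)) // size_polyX.
rewrite big_ord_recl coefXM rmorph0 scale0r add0r linear_sum.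
by apply: eq_bigr => i _; rewrite coefXM linearZ.
Qed.

Lemma actC k x : act k%:P x = k%:C%C *: x.
Proof. by rewrite -alg_polyC actZ act1. Qed.

Lemma actM p q x : act (p * q) x = act p (act q x).
Proof.
elim/poly_ind: p => [|p c IH].
  by rewrite mul0r /act size_poly0 !big_ord0.
rewrite [p * 'X]mulrC mulrDl -mulrA actD actXM IH mul_polyC actZ.
by rewrite actD actXM actC.
Qed.

Lemma actX x : act 'X x = T x.
Proof. by rewrite -['X]mulr1 actXM act1. Qed.

Lemma act_sym p x y : ip (act p x) y = ip x (act p y).
Proof.
elim/poly_ind: p x y => [|p c IH] x y.
  by rewrite -polyC0 !actC ipZl ipZr conj_real rmorph0 !scale0r.
rewrite actD [in RHS]actD [p * 'X]mulrC actXM mulrC actM actX !actC.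
by rewrite ipDl ipDr T_sym IH ipZl ipZr conj_real.
Qed.

Definition act_le (p : {poly R}) (M : R) :=
  forall x, rnorm (act p x) <= M * rnorm x.

Lemma act_leD p q M N : act_le p M -> act_le q N -> act_le (p + q) (M + N).
Proof.
move=> pM qN x; rewrite actD mulrDl.
exact: le_trans (rnormD _ _) (lerD (pM x) (qN x)).
Qed.

Lemma act_leZ k p M : act_le p M -> act_le (k *: p) (`|k| * M).
Proof. by move=> pM x; rewrite actZ rnormZ -mulrA ler_wpM2l. Qed.

Lemma act_leN p M : act_le p M -> act_le (- p) M.
Proof. by move=> pM x; rewrite actN rnormN. Qed.

Lemma act_leM p q M N : 0 <= M ->
  act_le p M -> act_le q N -> act_le (p * q) (M * N).
Proof.
move=> M0 pM qN x; rewrite actM -mulrA.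
exact: le_trans (pM _) (ler_wpM2l M0 (qN x)).
Qed.

Lemma act_le_trans p M N : M <= N -> act_le p M -> act_le p N.
Proof.
by move=> MN pM x; rewrite (le_trans (pM x)) // ler_wpM2r // rnorm_ge0.
Qed.

Lemma act_leX : act_le 'X 2^-1.
Proof. by move=> x; rewrite actX. Qed.

Lemma act_le1 : act_le 1 1.
Proof. by move=> x; rewrite act1 mul1r. Qed.

(** A root g of g = (X^2 + g^2) / 2 satisfies (1 - g)^2 = 1 - X^2; these are the
    iterates of that fixed-point equation, so [1 - root_approx n] approximates
    sqrt (1 - X^2). *)
Fixpoint root_approx n : {poly R} :=
  if n is m.+1 then 2^-1 *: ('X ^+ 2 + root_approx m ^+ 2) else 0.

Definition root_err n : {poly R} :=
  'X ^+ 2 - 2 *: root_approx n + root_approx n ^+ 2.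

(** The bound 1/2 on T is what makes the ball of radius 1/2 stable under the
    iteration: (1/4 + 1/4) / 2 <= 1/2. *)
Lemma root_approx_le n : act_le (root_approx n) 2^-1.
Proof.
elim: n => [|n IH] /=.
  move=> x; rewrite -polyC0 actC rmorph0 scale0r rnorm0.
  by rewrite mulr_ge0 ?rnorm_ge0 // invr_ge0.
have h0 : 0 <= 2^-1 :> R by rewrite invr_ge0.
apply: act_le_trans (act_leZ _ (act_leD (act_leM h0 act_leX act_leX)
  (act_leM h0 IH IH))).
by rewrite ger0_norm //; lra.
Qed.

(** With g_n the iterates, err_n.+1 = g_n.+1^2 - g_n^2 and
    g_n.+1 - g_n = err_n / 2; the error thus contracts by the factor
    |g_n.+1 + g_n| / 2 <= 1/2. *)
Lemma root_errS n :
  root_err n.+1 = 2^-1 *: (root_err n * (root_approx n.+1 + root_approx n)).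
Proof.
rewrite /root_err /=; set g := root_approx n; set x : {poly R} := 'X.
have two : (2 : {poly R}) * (2^-1)%:P = 1.
  by rewrite -polyC_natr -polyCM divff // pnatr_eq0.
have h2 : 2%:P = 2 :> {poly R} by rewrite polyC_natr.
rewrite -!mul_polyC h2; move: (2^-1)%:P two => h two.
(* [ring] treats h as a variable, so the multiple of 1 - 2 h by which the two
   sides differ has to be written out. *)
set lhs := LHS; set rhs := RHS.
have -> : lhs = rhs + (1 - 2 * h) * (x ^+ 2 - h * (x ^+ 2 + g ^+ 2) * g).
  by rewrite /lhs /rhs; ring.
by rewrite two subrr mul0r addr0.
Qed.

Lemma root_err_le n : act_le (root_err n) (2^-1 ^+ n).
Proof.
elim: n => [|n IH].
  rewrite /root_err /= scaler0 expr0n subr0 addr0.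
  have h0 : 0 <= 2^-1 :> R by rewrite invr_ge0.
  by apply: act_le_trans (act_leM h0 act_leX act_leX); lra.
have h0 : 0 <= 2^-1 :> R by rewrite invr_ge0.
rewrite root_errS; apply: act_le_trans (act_leZ _ (act_leM (exprn_ge0 n h0) IH
   (act_leD (root_approx_le n.+1) (root_approx_le n)))).
rewrite ger0_norm // exprS; lra.
Qed.

(** With U = s T + i (1 - g), the cross terms of <U x, U x> cancel because T and
    g are symmetric and commute, and what is left is
    <x, (T^2 + (1 - g)^2) x> = <x, (1 + err) x>: U is nearly isometric. *)
Lemma root_isometry n x (s : R) : s ^+ 2 = 1 ->
  rnorm (s%:C%C *: T x + 'i *: act (1 - root_approx n) x) ^+ 2
    <= (1 + 2^-1 ^+ n) * rnorm x ^+ 2.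
Proof.
move=> s2; set p := 1 - root_approx n.
have isom : ip (act (s *: 'X) x + 'i *: act p x) (act (s *: 'X) x + 'i *: act p x)
    = ip x (act (1 + root_err n) x).
  rewrite ipDl !ipDr !ipZl !ipZr conjCi !act_sym -!actM [p * (s *: _)]mulrC.
  rewrite scalerA mulNr mulCii opprK scale1r scaleNr addrA addrK.
  rewrite -ipDr -actD; congr (ip x (act _ x)).
  rewrite -scalerAl -scalerAr scalerA -expr2 s2 scale1r /p /root_err.
  by rewrite scaler_nat; ring.
rewrite -actX -actZ -ip_norm isom expr2 mulrCA.
apply: le_trans (ip_le _ _) (ler_wpM2l (rnorm_ge0 _) _).
exact: act_leD act_le1 (root_err_le n) x.
Qed.

(** The operators of [root_isometry] for s = 1 and s = -1 add up to
    2 i (1 - g). *)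
Lemma root_le n x :
  rnorm (act (1 - root_approx n) x) ^+ 2 <= (1 + 2^-1 ^+ n) * rnorm x ^+ 2.
Proof.
set y := act _ x; set M := _ * _.
have M0 : 0 <= M by rewrite mulr_ge0 ?addr_ge0 ?exprn_ge0 ?invr_ge0 ?rnorm_ge0.
have Up : rnorm (T x + 'i *: y) ^+ 2 <= M.
  by have := @root_isometry n x 1 (expr1n _ _); rewrite rmorph1 scale1r.
have Um : rnorm (- T x + 'i *: y) ^+ 2 <= M.
  have := @root_isometry n x (-1) (sqrr_sign _ 1).
  by rewrite rmorphN rmorph1 scaleN1r.
have : rnorm ((T x + 'i *: y) + (- T x + 'i *: y)) = 2 * rnorm y.
  rewrite addrACA addrN add0r -scalerDr rnormZi.
  have -> : y + y = (2%:R : R)%:C%C *: y by rewrite rmorph_nat scaler_nat mulr2n.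
  by rewrite rnormZ normr_nat.
have := rnormD (T x + 'i *: y) (- T x + 'i *: y) => /[swap] ->.
move: (rnorm_ge0 y) Up Um; clearbody M.
set a := rnorm y; set b := rnorm (T x + _); set c := rnorm (- T x + _).
move=> a0 b2 c2 abc; have : (2 * a) ^+ 2 <= (b + c) ^+ 2.
  by rewrite lerXn2r ?nnegrE ?addr_ge0 ?mulr_ge0 ?rnorm_ge0.
have := sqr_ge0 (b - c); lra.
Qed.

Lemma act_le_lim p M N : (forall n, act_le p (M + N * 2^-1 ^+ n)) -> act_le p M.
Proof.
move=> H x; apply/ler_addgt0Pr => e e0.
set K := `|N| * rnorm x.
have K0 : 0 <= K by rewrite mulr_ge0 ?rnorm_ge0.
have [m Km] : exists m, K * 2^-1 ^+ m <= e.
  have [m mP] : exists m : nat, K / e < m%:R.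
    exists (Num.trunc (K / e)).+1; exact: truncnS_gt.
  exists m; rewrite exprVn ler_pdivrMr ?exprn_gt0 //.
  rewrite -ler_pdivrMl // mulrC (le_trans (ltW mP)) //.
  by rewrite -natrX ler_nat ltnW // ltn_expl.
apply: le_trans (H m x) _; rewrite mulrDl lerD2l; apply: le_trans Km.
rewrite mulrAC ler_wpM2r ?exprn_ge0 ?invr_ge0 //.
by rewrite ler_wpM2r ?rnorm_ge0 // ler_norm.
Qed.

(** This is the substitute for the positivity of T^2 and for functional
    calculus: 1 - T^2 = (1 - g_n)^2 - err_n, where the first term has norm at
    most 1 + 2^-n and the second one at most 2^-n. *)
Lemma act_le_subX2 : act_le (1 - 'X ^+ 2) 1.
Proof.
apply: (@act_le_lim _ _ 2) => n x.
set p := 1 - root_approx n; set d := 2^-1 ^+ n.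
have d0 : 0 <= d by rewrite exprn_ge0 // invr_ge0.
have -> : 1 - 'X ^+ 2 = p * p - root_err n.
  by rewrite /p /root_err scaler_nat; ring.
have -> : 1 + 2 * d = (1 + d) + d by ring.
apply: act_leD; last exact: act_leN (root_err_le n).
move=> z; rewrite actM.
have h1 := root_le n z; have h2 := root_le n (act p z).
have N0 := rnorm_ge0 z; have M0 := rnorm_ge0 (act p (act p z)).
rewrite -(@ler_pXn2r _ 2) ?nnegrE ?mulr_ge0 ?addr_ge0 //.
rewrite exprMn [(1 + d) ^+ 2]expr2 -mulrA.
by apply: le_trans h2 (ler_wpM2l _ h1); rewrite addr_ge0.
Qed.

Definition cesaro n : {poly R} := n.+1%:R^-1 *: \sum_(k < n.+1) (1 - 'X ^+ 2) ^+ k.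

Lemma act_le_subX2_exp n : act_le ((1 - 'X ^+ 2) ^+ n) 1.
Proof.
elim: n => [|n IH]; first exact: act_le1.
by rewrite exprS -[X in act_le _ X]mulr1; apply: act_leM act_le_subX2 IH.
Qed.

Lemma cesaro_le n : act_le (cesaro n) 1.
Proof.
have sum_le m : act_le (\sum_(k < m) (1 - 'X ^+ 2) ^+ k) m%:R.
  elim: m => [|m IH]; last by rewrite big_ord_recr -natr1;
    apply: act_leD IH (act_le_subX2_exp m).
  by move=> x; rewrite big_ord0 -polyC0 actC rmorph0 scale0r rnorm0 mul0r.
apply: act_le_trans (act_leZ _ (sum_le n.+1)).
by rewrite ger0_norm ?invr_ge0 // mulVf // pnatr_eq0.
Qed.

(** The sum telescopes: X^2 = 1 - S for S = 1 - X^2, so X^2 times the sum of the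
    S^k is 1 - S^(n+1), a difference of two contractions. *)
Lemma cesaroX2_le n : act_le ('X ^+ 2 * cesaro n) (2 / n.+1%:R).
Proof.
have -> : 'X ^+ 2 * cesaro n = n.+1%:R^-1 *: (1 - (1 - 'X ^+ 2) ^+ n.+1).
  rewrite /cesaro -scalerAr; congr (_ *: _).
  have /= := subrXX (1 : {poly R}) (1 - 'X ^+ 2) n.+1; rewrite expr1n subKr => ->.
  by congr (_ * _); apply: eq_bigr => i _; rewrite expr1n mul1r.
apply: act_le_trans (act_leZ _ (act_leD act_le1 (act_leN (act_le_subX2_exp n.+1)))).
by rewrite ger0_norm ?invr_ge0 // mulrC.
Qed.

Lemma cesaro_horner0 n : (cesaro n).[0] = 1.
Proof.
rewrite hornerZ horner_sum (eq_bigr (fun=> 1)) => [|k _].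
  by rewrite sumr_const card_ord mulVf // pnatr_eq0.
by rewrite !hornerE /= expr0n subr0 expr1n.
Qed.

(** Passing from T^2 to T: by symmetry |T z|^2 = |<z, T^2 z>|, with
    z = r_n(T) x. *)
Lemma cesaroX_le n x :
  rnorm (act ('X * cesaro n) x) ^+ 2 <= 2 / n.+1%:R * rnorm x ^+ 2.
Proof.
have -> : rnorm (act ('X * cesaro n) x) ^+ 2 =
    rnorm (ip (act (cesaro n) x) (act ('X ^+ 2 * cesaro n) x)).
  by rewrite -ip_norm [in X in ip X _]actM act_sym -actM mulrA.
apply: le_trans (ip_le _ _) _.
rewrite expr2 mulrCA ler_pM ?rnorm_ge0 //; last exact: cesaroX2_le.
by rewrite -[leRHS]mul1r; apply: cesaro_le.
Qed.

(** The factor r = 1 - X q takes the value 1 at 0, yet X r is small: r(T) is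
    close to the projection onto the kernel of T. *)
Lemma vanishing_factor e : 0 < e -> exists q : {poly R},
  act_le (1 - 'X * q) 1 /\ act_le ('X * (1 - 'X * q)) e.
Proof.
move=> e0; have [n ne] : exists n : nat, 2 / n.+1%:R <= e ^+ 2.
  exists (Num.trunc (2 / e ^+ 2)).
  rewrite ler_pdivrMr ?ltr0n // -ler_pdivrMl ?exprn_gt0 // mulrC.
  exact: ltW (truncnS_gt _).
have [q qP] : exists q, cesaro n = 1 - 'X * q.
  have /factor_theorem[q qP] : root (1 - cesaro n) 0.
    by rewrite /root -polyC1 hornerD hornerN hornerC cesaro_horner0 subrr.
  by exists q; move: qP; rewrite polyC0 subr0 mulrC => <-; rewrite subKr.
exists q; rewrite -qP; split; first exact: cesaro_le.
move=> x; rewrite -(@ler_pXn2r _ 2) ?nnegrE ?mulr_ge0 ?rnorm_ge0 ?(ltW e0) //.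
rewrite exprMn; apply: le_trans (cesaroX_le n x) _.
by rewrite ler_wpM2r // exprn_ge0 // rnorm_ge0.
Qed.

End SymmetricOperator.

(** * Closed subspaces and closed spans *)

Section ClosedSubspaces.
Context {R : realType}.
Implicit Types V : normedModType R[i].

Definition approximable V (X : set V) (x : V) :=
  forall e : R, 0 < e -> exists2 y, X y & rnorm (x - y) <= e.

Lemma closure_approximable V (X : set V) x : closure X x <-> approximable X x.
Proof.
split=> [Xx e e0|Xx A /nbhs_ballP[e e0 xA]].
  have e0' : 0 < e%:C%C :> R[i] by rewrite ltcR.
  have [y [Xy]] := Xx _ (nbhsx_ballx x e%:C%C e0').
  by rewrite -ball_normE /= rnormE ltcR => /ltW ?; exists y.
have eE : e = (complex.Re e)%:C%C by rewrite RRe_real // gtr0_real.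
have e0' : 0 < complex.Re e by move: e0; rewrite /= eE ltcR.
have [y Xy yx] := Xx (complex.Re e / 2) (divr_gt0 e0' (ltr0n _ 2)).
exists y; split => //; apply: xA; rewrite -ball_normE /= rnormE eE ltcR.
lra.
Qed.

Lemma closed_subspaceP V (X : set V) : closed_subspace X <->
  [/\ X 0, forall (k : R[i]) x y, X x -> X y -> X (k *: x + y)
    & forall x, approximable X x -> X x].
Proof.
split=> [[Xc [X0 XD]]|[X0 XD Xc]].
  split=> [|k x y Xx Xy|x /closure_approximable]; last exact: Xc.
    by move: X0; rewrite inE.
  by have := XD k x y; rewrite !inE; apply.
split; first by move=> x /closure_approximable/Xc.
split; first by rewrite inE.
by move=> k x y; rewrite !inE; apply: XD.
Qed.

Lemma closed_subspace_forall V I (X : I -> set V) :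
  (forall i, closed_subspace (X i)) -> closed_subspace [set x | forall i, X i x].
Proof.
move=> Xi; apply/closed_subspaceP; split=> [i|k x y Xx Xy i|x Xx i];
  have /closed_subspaceP[X0 XD Xc] := Xi i => //; first exact: XD.
by apply: Xc => e /Xx[y Xy xy]; exists y.
Qed.

Lemma closed_subspace_preimage V V' (f : V -> V') (M : R) (Y : set V') :
  linear f -> (forall x, rnorm (f x) <= M * rnorm x) ->
  closed_subspace Y -> closed_subspace (f @^-1` Y).
Proof.
move=> fP fM /closed_subspaceP[Y0 YD Yc].
have f0 : f 0 = 0.
  apply/eqP; rewrite -normr_eq0 rnormE eq_complex /= eqxx andbT.
  by rewrite eq_le rnorm_ge0 andbT (le_trans (fM 0)) // rnorm0 mulr0.
have fB x y : f (x - y) = f x - f y.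
  by rewrite -scaleN1r addrC fP scaleN1r addrC.
apply/closed_subspaceP; split=> [|k x y Yx Yy|x Yx] /=; first by rewrite f0.
  by rewrite fP; apply: YD.
apply: Yc => e e0; pose K := `|M| + 1.
have K0 : 0 < K by rewrite ltr_pwDr.
have [y Yy xy] := Yx (e / K) (divr_gt0 e0 K0); exists (f y) => //.
rewrite -fB; apply: le_trans (fM _) _.
have MK : M <= K by rewrite (le_trans (ler_norm _)) // lerDl.
apply: le_trans (ler_wpM2r (rnorm_ge0 _) MK) _.
by rewrite mulrC -ler_pdivlMr.
Qed.

Lemma closed_span_min V (X Y : set V) :
  X `<=` Y -> closed_subspace Y -> closed_span X `<=` Y.
Proof.
move=> XY /closed_subspaceP[Y0 YD Yc] x /closure_approximable Xx.
apply: Yc => e /Xx[y [n [k [z [Xz ->]]]] xy]; exists (\sum_(i < n) k i *: z i) => //.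
elim/big_ind: _ => // [a b Ya Yb|i _]; first by rewrite -[a]scale1r; apply: YD.
by rewrite -[_ *: _]addr0; apply: YD => //; apply/XY/Xz.
Qed.

Lemma closed_span_mono V (X Y : set V) :
  X `<=` Y -> closed_span X `<=` closed_span Y.
Proof.
move=> XY; apply: closureS => _ [n [k [x [Xx ->]]]].
by exists n, k, x; split=> // i; apply/XY/Xx.
Qed.

Lemma approximable_closed_span V (X : set V) x :
  approximable X x -> closed_span X x.
Proof.
move=> Xx; apply/closure_approximable => e /Xx[y Xy xy]; exists y => //.
by exists 1%N, (fun=> 1), (fun=> y); rewrite big_ord1 scale1r.
Qed.

Lemma approximable_self V (X : set V) x : X x -> approximable X x.
Proof. by move=> Xx e e0; exists x => //; rewrite subrr rnorm0 ltW. Qed.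

Lemma sub_closed_span V (X : set V) : X `<=` closed_span X.
Proof. by move=> x Xx; apply/approximable_closed_span/approximable_self. Qed.

Lemma closed_subspace_approximable V (X : set V) x :
  closed_subspace X -> approximable X x -> X x.
Proof. by move=> /closed_subspaceP[_ _]; apply. Qed.

End ClosedSubspaces.

(** * Fell bundles and the approximate factorization *)

Section FellBundle.
Context {R : realType} {G : groupType} (B : fell_bundle R G).
Local Notation C := R[i].

(** The proof indexing a product carries no information, since equality in a
    group is decidable. *)
Lemma fmul_irr (s t u : G) (e e' : (s * t)%g = u) : fmul B e = fmul B e'.
Proof. by rewrite (eq_irrelevance e e'). Qed.

Lemma fmulDl (s t u : G) (e : (s * t)%g = u) (a b : B s) (c : B t) :
  fmul B e (a + b) c = fmul B e a c + fmul B e b c.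
Proof. by have := fmul_linearl e c 1 a b; rewrite !scale1r. Qed.

Lemma fmulDr (s t u : G) (e : (s * t)%g = u) (a : B s) (b c : B t) :
  fmul B e a (b + c) = fmul B e a b + fmul B e a c.
Proof. by have := fmul_linearr e a 1 b c; rewrite !scale1r. Qed.

Lemma fmul0l (s t u : G) (e : (s * t)%g = u) (c : B t) : fmul B e 0 c = 0.
Proof. by apply: (@addrI _ (fmul B e 0 c)); rewrite -fmulDl !addr0. Qed.

Lemma fmul0r (s t u : G) (e : (s * t)%g = u) (a : B s) : fmul B e a 0 = 0.
Proof. by apply: (@addrI _ (fmul B e a 0)); rewrite -fmulDr !addr0. Qed.

Lemma fmulZl (s t u : G) (e : (s * t)%g = u) (k : C) (a : B s) (c : B t) :
  fmul B e (k *: a) c = k *: fmul B e a c.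
Proof. by have := fmul_linearl e c k a 0; rewrite fmul0l !addr0. Qed.

Lemma fmulZr (s t u : G) (e : (s * t)%g = u) (k : C) (a : B s) (c : B t) :
  fmul B e a (k *: c) = k *: fmul B e a c.
Proof. by have := fmul_linearr e a k c 0; rewrite fmul0r !addr0. Qed.

Lemma fstarD (s t : G) (e : (s^-1)%g = t) (a b : B s) :
  fstar B e (a + b) = fstar B e a + fstar B e b.
Proof. by have := fstar_semilinear e 1 a b; rewrite conjC1 !scale1r. Qed.

Lemma fstar0 (s t : G) (e : (s^-1)%g = t) : fstar B e 0 = 0.
Proof. by apply: (@addrI _ (fstar B e 0)); rewrite -fstarD !addr0. Qed.

Lemma fstarZ (s t : G) (e : (s^-1)%g = t) (k : C) (a : B s) :
  fstar B e (k *: a) = k^* *: fstar B e a.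
Proof. by have := fstar_semilinear e k a 0; rewrite fstar0 !addr0. Qed.

Lemma fstarB (s t : G) (e : (s^-1)%g = t) (a b : B s) :
  fstar B e (a - b) = fstar B e a - fstar B e b.
Proof. by rewrite fstarD -(scaleN1r b) fstarZ rmorphN rmorph1 scaleN1r. Qed.

Lemma fmul_rnorm (s t u : G) (e : (s * t)%g = u) (a : B s) (b : B t) :
  rnorm (fmul B e a b) <= rnorm a * rnorm b.
Proof.
by rewrite -lecR rmorphM /= -!rnormE fmul_norm.
Qed.

Lemma fstar_rnorm (s t : G) (e : (s^-1)%g = t) (a : B s) :
  rnorm (fstar B e a) = rnorm a.
Proof. by rewrite /rnorm fstar_norm. Qed.

Lemma fstar_mul_rnorm (s t u : G) (es : (t^-1)%g = s) (e : (s * t)%g = u)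
    (a : B t) : u = 1%g -> rnorm (fmul B e (fstar B es a) a) = rnorm a ^+ 2.
Proof.
move=> u1; subst s; move: e; rewrite u1 => e.
apply: complexI; rewrite rmorphXn /= -!rnormE -fstar_mul_norm.
by rewrite (fmul_irr e (mulVg t)).
Qed.

Definition left_mul t (h : B 1%g) (k : C) (v : B t) : B t :=
  k *: fmul B (mul1g t) h v.

Lemma left_mul_linear t h k : linear (@left_mul t h k).
Proof.
move=> a u v; rewrite /left_mul fmulDr fmulZr scalerDr !scalerA.
by rewrite (mulrC k).
Qed.

HB.instance Definition _ t h k := GRing.isLinear.Build C (B t) (B t) *:%R
  (@left_mul t h k) (@left_mul_linear t h k).

Definition inner t (z w : B t) : B 1%g := fmul B (mulVg t) (fstar B erefl z) w.

(** With h = y y^* and T = c h, take r = 1 - X q from [vanishing_factor].  Then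
    y - r(T) y = T q(T) y = h (c q(T) y) has the required form, and r(T) y is
    small: w = <r y, r y> = <y, r^2 y> has |w| = |r y|^2, while
    w^* w = (r^2 y)^* y y^* (r^2 y) = <r^2 y, h r^2 y> is controlled by
    T r. *)
Lemma approx_factor (t s : G) (es : (t^-1)%g = s) (e : (t * s)%g = 1%g)
    (e1 : (1 * t)%g = t) (y : B t) :
  approximable [set fmul B e1 (fmul B e y (fstar B es y)) v | v in setT] y.
Proof.
subst s; rewrite (fmul_irr e (mulgV t)) (fmul_irr e1 (mul1g t)).
set h := fmul B (mulgV t) _ _; move=> eta eta0.
(* Chosen so that c |h| <= 1/2, as the estimates on T require. *)
pose c : R := (2 * (rnorm h + 1))^-1.
have h1 : 0 < rnorm h + 1 by rewrite ltr_wpDl ?rnorm_ge0.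
have c0 : 0 < c by rewrite invr_gt0 mulr_gt0.
have hS : fstar B (invg1 G) h = h.
  by rewrite /h (fstarM (mulgV t) erefl (invgK t) (invg1 G) (mulgV t)) fstarK.
pose T : {linear B t -> B t} := @left_mul t h c%:C%C.
have TE v : T v = c%:C%C *: fmul B (mul1g t) h v by [].
have Thalf v : rnorm (T v) <= 2^-1 * rnorm v.
  rewrite TE rnormZ gtr0_norm // (le_trans (ler_wpM2l (ltW c0) (fmul_rnorm _ _ _))) //.
  rewrite mulrA ler_wpM2r ?rnorm_ge0 // mulrC ler_pdivrMr ?mulr_gt0 //; lra.
have ipDl (x z w : B t) : inner (x + z) w = inner x w + inner z w.
  by rewrite /inner fstarD fmulDl.
have ipDr (x z w : B t) : inner x (z + w) = inner x z + inner x w.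
  by rewrite /inner fmulDr.
have ipZl k (x z : B t) : inner (k *: x) z = k^* *: inner x z.
  by rewrite /inner fstarZ fmulZl.
have ipZr k (x z : B t) : inner x (k *: z) = k *: inner x z.
  by rewrite /inner fmulZr.
have ip_le (x z : B t) : rnorm (inner x z) <= rnorm x * rnorm z.
  by rewrite (le_trans (fmul_rnorm _ _ _)) // fstar_rnorm.
have ip_norm (x : B t) : rnorm (inner x x) = rnorm x ^+ 2.
  exact: fstar_mul_rnorm.
have Tsym (x z : B t) : inner (T x) z = inner x (T z).
  rewrite !TE ipZl ipZr conj_real /inner; congr (_ *: _).
  rewrite (fstarM (mul1g t) (invg1 G) erefl erefl (mulg1 _)) hS.
  exact: fmulA.
(* The final estimate is c |r y|^4 <= eta' |y|^2, to be compared with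
   c eta^4. *)
pose eta' := c * eta ^+ 4 / (rnorm y ^+ 2 + 1).
have y1 : 0 < rnorm y ^+ 2 + 1 by rewrite ltr_wpDl ?exprn_ge0 ?rnorm_ge0.
have eta'0 : 0 < eta' by rewrite divr_gt0 ?mulr_gt0 ?exprn_gt0.
have [q [r_le Xr_le]] := vanishing_factor ipDl ipDr ipZl ipZr ip_le ip_norm Thalf Tsym eta'0.
set r := 1 - 'X * q in r_le Xr_le.
exists (fmul B (mul1g t) h (c%:C%C *: act T q y)); first by eexists.
rewrite fmulZr -TE -actXM.
have -> : y - act T ('X * q) y = act T r y by rewrite /r actB act1.
pose y' := act T (r * r) y; pose w := inner y y'.
have wE : rnorm w = rnorm (act T r y) ^+ 2.
  by rewrite -ip_norm act_sym // -actM.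
have ww : rnorm w ^+ 2 <= rnorm y' * rnorm (fmul B (mul1g t) h y').
  have e0 : (t^-1 * t)%g = (1^-1)%g :> G by rewrite invg1 mulVg.
  rewrite -(fstar_mul_rnorm erefl (mulVg 1%g)) //.
  rewrite (fstarM (mulVg t) (invgK t) erefl erefl e0) fstarK.
  rewrite (fmulA e0 (mulVg 1%g) (mulg1 t) (mulVg t)).
  rewrite -(fmulA (mulgV t) (mul1g t) (mulVg t) (mulg1 t)).
  by rewrite (le_trans (fmul_rnorm _ _ _)) // fstar_rnorm.
have ry : rnorm (act T r y) <= rnorm y by have := r_le y; rewrite mul1r.
have y'_le : rnorm y' <= rnorm y.
  by rewrite /y' actM (le_trans (r_le _)) // mul1r.
have hy' : c * rnorm (fmul B (mul1g t) h y') <= eta' * rnorm y.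
  rewrite -[c in leLHS]gtr0_norm // -rnormZ -TE -actXM mulrA actM.
  by rewrite (le_trans (Xr_le _)) // ler_wpM2l // ltW.
rewrite -(@ler_pXn2r _ 4) ?nnegrE ?rnorm_ge0 ?(ltW eta0) //.
rewrite -(ler_pM2l c0) (exprM _ 2 2) -wE.
apply: le_trans (ler_wpM2l (ltW c0) ww) _.
rewrite mulrCA; apply: le_trans (ler_pM _ _ y'_le hy') _.
- exact: rnorm_ge0.
- by rewrite mulr_ge0 ?rnorm_ge0 // ltW.
rewrite mulrCA -expr2 /eta' mulrAC ler_pdivrMr // ler_wpM2l ?lerDl //.
by rewrite mulr_ge0 ?exprn_ge0 // ltW.
Qed.

End FellBundle.

Arguments approx_factor {R G B t s} es e e1 y.

(** * Ideals of the bundle and invariant ideals of the unit fiber *)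

Section Ideals.
Context {R : realType} {G : groupType} (B : fell_bundle R G).

Lemma mem_of_factor (t s : G) (es : (t^-1)%g = s) (e : (t * s)%g = 1%g)
    (e1 : (1 * t)%g = t) (X : set (B t)) (y : B t) : closed_subspace X ->
  (forall v, X (fmul B e1 (fmul B e y (fstar B es y)) v)) -> X y.
Proof.
move=> Xc XP; apply: closed_subspace_approximable Xc _ => d d0.
by have [_ [v _ <-] yv] := approx_factor es e e1 y d d0; eexists; last exact: yv.
Qed.

Lemma closed_subspace_mulr (s t u : G) (e : (s * t)%g = u) (b : B t)
    (X : set (B u)) :
  closed_subspace X -> closed_subspace [set a | X (fmul B e a b)].
Proof.
apply: (closed_subspace_preimage (M := rnorm b)) => //.
- exact: fmul_linearl.
- by move=> a; rewrite mulrC fmul_rnorm.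
Qed.

Lemma closed_subspace_mull (s t u : G) (e : (s * t)%g = u) (a : B s)
    (X : set (B u)) :
  closed_subspace X -> closed_subspace [set b | X (fmul B e a b)].
Proof.
apply: (closed_subspace_preimage (M := rnorm a)) => //.
- exact: fmul_linearr.
- by move=> b; rewrite fmul_rnorm.
Qed.

Lemma set_fiber_of_fibers (X : forall t : G, set (B t)) t :
  set_fiber (set_of_fibers X) t = X t.
Proof. by []. Qed.

Lemma total_ext (J K : set (total B)) :
  (forall t, set_fiber J t = set_fiber K t) -> J = K.
Proof.
move=> JK; apply/funext => -[t y].
by have /(congr1 (fun X : set (B t) => X y)) := JK t.
Qed.

Lemma induced_min (I : set (B 1%g)) t (X : set (B t)) : closed_subspace X ->
  (forall i c, I i -> X (fmul B (mul1g t) i c)) ->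
  set_fiber (induced B I) t `<=` X.
Proof.
rewrite set_fiber_of_fibers => Xc XI.
by apply: closed_span_min Xc => _ [i [c [Ii _ ->]]]; apply: XI.
Qed.

Lemma factor_induced (I : set (B 1%g)) (t s : G) (es : (t^-1)%g = s)
    (e : (t * s)%g = 1%g) (y : B t) :
  I (fmul B e y (fstar B es y)) -> set_fiber (induced B I) t y.
Proof.
rewrite set_fiber_of_fibers => Iy; apply: approximable_closed_span => d d0.
have [_ [v _ <-] yv] := approx_factor es e (mul1g t) y d d0.
by eexists; last exact: yv; exists (fmul B e y (fstar B es y)), v.
Qed.

Section UnitFiberIdeal.
Context (I : set (B 1%g)) (Ideal : ideal_unit_fiber I).

Let Iclosed : closed_subspace I. Proof. by case: Ideal. Qed.

Lemma ideal_mulr (e : (1 * 1)%g = 1%g) x b : I x -> I (fmul B e x b).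
Proof. by move=> Ix; rewrite (fmul_irr B e (mulg1 1%g)); case: (Ideal.2 x b Ix). Qed.

Lemma ideal_mull (e : (1 * 1)%g = 1%g) x b : I x -> I (fmul B e b x).
Proof. by move=> Ix; rewrite (fmul_irr B e (mulg1 1%g)); case: (Ideal.2 x b Ix). Qed.

(** The factorization of x^* reads x^* = lim (x^* x) v, and x^* x is in I. *)
Lemma ideal_star (e : (1^-1)%g = 1%g) x : I x -> I (fstar B e x).
Proof.
move=> Ix; apply: (mem_of_factor (es := e) (e := mulg1 _) (e1 := mulg1 _) Iclosed).
by move=> v; rewrite fstarK; apply/ideal_mulr/ideal_mull.
Qed.

(** From right to left, b = y^* already suffices, by the approximate
    factorization of y.  From left to right, the condition on y is closed and
    linear, and it holds on I B_t because (i c) b = i (c b). *)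
Lemma inducedP t (y : B t) : set_fiber (induced B I) t y <->
  forall s (e : (t * s)%g = 1%g) (b : B s), I (fmul B e y b).
Proof.
split=> [Iy s e b|Iy]; last exact: (factor_induced (Iy _ (mulgV t) (fstar B erefl y))).
move: y Iy; apply: induced_min; first exact: closed_subspace_mulr.
by move=> i c Ii /=; rewrite (fmulA _ _ e (mulg1 1%g)); apply: ideal_mulr.
Qed.

Lemma induced_closed t : closed_subspace (set_fiber (induced B I) t).
Proof.
have -> : set_fiber (induced B I) t = [set y | forall s (e : (t * s)%g = 1%g)
    (b : B s), I (fmul B e y b)] by apply/seteqP; split=> y /inducedP.
by do 3!apply: closed_subspace_forall => ?; apply: closed_subspace_mulr.
Qed.

Lemma induced_unit : set_fiber (induced B I) 1%g = I.
Proof.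
apply/seteqP; split=> x; last first.
  move=> Ix; apply/inducedP => s e b.
  have s1 : s = 1%g by rewrite -[s]mul1g.
  by subst s; apply: ideal_mulr.
move=> /inducedP Ix.
apply: (mem_of_factor (es := invg1 G) (e := mulg1 _) (e1 := mulg1 _) Iclosed).
by move=> v; apply/ideal_mulr/Ix.
Qed.

End UnitFiberIdeal.

Section InvariantIdeal.
Context (I : set (B 1%g)) (Inv : invariant_ideal B I).

Let Ideal : ideal_unit_fiber I. Proof. by case: Inv. Qed.
Let Iclosed : closed_subspace I. Proof. by case: Ideal. Qed.

Lemma invariant_conj s t u (e1 : (s * 1)%g = u) (e2 : (u * t)%g = 1%g) a i b :
  I i -> I (fmul B e2 (fmul B e1 a i) b).
Proof.
move=> Ii; subst u.
have st : (s^-1)%g = t by apply: (mulgI s); rewrite mulgV -{1}e2 mulg1.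
subst t; case: Inv => _ /(_ s); apply; apply: sub_closed_span.
exists a, i, b; split=> //; last by rewrite (fmul_irr B _ e2).
by exists (fstar B (invgK s) b) => //; apply: fstarK.
Qed.

(** This mirror image of [inducedP] is where invariance is used: b (i c) lies in
    B_s I B_s^*.  For the converse, y^* y in I puts y^* in I_{t^-1}; the direct
    part for y^* then gives y y^* in I. *)
Lemma inducedP_left t (y : B t) : set_fiber (induced B I) t y <->
  forall s (e : (s * t)%g = 1%g) (b : B s), I (fmul B e b y).
Proof.
have left_mem u (z : B u) s (e : (s * u)%g = 1%g) (b : B s) :
    set_fiber (induced B I) u z -> I (fmul B e b z).
  move: z; apply: induced_min; first exact: closed_subspace_mull.
  have e' : (s * 1 * u)%g = 1%g by rewrite mulg1.
  by move=> i c Ii /=; rewrite -(fmulA erefl e'); apply: invariant_conj.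
split=> [Iy s e b|Iy]; first exact: left_mem.
apply/(factor_induced (es := erefl) (e := mulgV t))/left_mem.
apply: (factor_induced (es := invgK t) (e := mulVg t)).
by rewrite fstarK; apply: Iy.
Qed.

(** The involution exchanges the two descriptions of I_t: y^* b is the adjoint
    of b^* y, and I is self-adjoint. *)
Lemma induced_star s t (e : (s^-1)%g = t) y :
  set_fiber (induced B I) s y -> set_fiber (induced B I) t (fstar B e y).
Proof.
move=> /(inducedP_left y) Iy; apply/(inducedP Ideal) => u eu b.
have e1 : (u^-1 * s)%g = 1%g.
  by have -> : u = s; [apply: (mulgI t); rewrite eu -e mulVg | rewrite mulVg].
rewrite -[X in I X](fstarK (invg1 G) (invg1 G)); apply: ideal_star => //.
have eK : (t^-1)%g = s by rewrite -e invgK.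
by rewrite (fstarM _ eK erefl _ e1) fstarK; apply: Iy.
Qed.

Lemma induced_mulr s t u (e : (s * t)%g = u) (a : B s) (b : B t) :
  set_fiber (induced B I) s a -> set_fiber (induced B I) u (fmul B e a b).
Proof.
move=> /(inducedP Ideal) Ia; apply/(inducedP Ideal) => v ev c.
have e1 : (s * (t * v))%g = 1%g by rewrite mulgA e.
by rewrite (fmulA e ev erefl e1); apply: Ia.
Qed.

Lemma induced_mull s t u (e : (s * t)%g = u) (a : B s) (b : B t) :
  set_fiber (induced B I) t b -> set_fiber (induced B I) u (fmul B e a b).
Proof.
move=> /inducedP_left Ib; apply/inducedP_left => v ev c.
have e1 : (v * s * t)%g = 1%g by rewrite -mulgA e.
by rewrite -(fmulA erefl e1 e ev); apply: Ib.
Qed.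

Lemma induced_subbundle : fell_subbundle (induced B I).
Proof.
split.
- by move=> t; apply: induced_closed.
- by move=> s t u e a b Ia _; apply: induced_mulr.
- by move=> s t e a; apply: induced_star.
- move=> t a Ia; have [c ac] := fstar_mul_ge0 a; exists c => //.
  rewrite induced_unit //.
  (* The square root c taken in B_1 belongs to I: c^* is the limit of
     (c^* c) v with c^* c = a^* a in I. *)
  have cc : I (fmul B (mulg1 1%g) (fstar B (invg1 G) c) c).
    by rewrite -ac; move/inducedP_left: Ia; apply.
  have Ics : I (fstar B (invg1 G) c).
    apply: (mem_of_factor (es := invg1 G) (e := mulg1 _) (e1 := mulg1 _) Iclosed).
    by move=> v; rewrite fstarK; apply: ideal_mulr.
  by rewrite -(fstarK (invg1 G) (invg1 G) c); apply: ideal_star.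
Qed.

Lemma induced_ideal : bundle_ideal B (induced B I).
Proof.
split; first exact: induced_subbundle.
- apply: total_ext => t; rewrite !set_fiber_of_fibers; apply/seteqP; split.
    apply: closed_span_min; last exact: (induced_closed Ideal t).
    by move=> _ [s [u [e [a [b [Ia _ ->]]]]]]; apply: induced_mulr.
  apply: closed_span_mono => _ [i [c [Ii _ ->]]].
  by exists 1%g, t, (mul1g t), i, c; rewrite induced_unit.
- apply: total_ext => t; rewrite !set_fiber_of_fibers; apply/seteqP; split.
    apply: closed_span_min; last exact: (induced_closed Ideal t).
    by move=> _ [s [u [e [a [b [_ Ib ->]]]]]]; apply: induced_mull.
  (* Adjoints turn y^* = lim (y^* y) v into y = lim v^* (y^* y). *)
  move=> y Iy; apply: approximable_closed_span => d d0.
  have [_ [v _ <-] yv] :=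
    approx_factor (invgK t) (mulVg t) (mul1g _) (fstar B erefl y) d d0.
  exists (fmul B (mulg1 t) (fstar B (invgK t) v) (fmul B (mulVg t) (fstar B erefl y) y)).
    exists t, 1%g, (mulg1 t); do 2!eexists; split => //.
    by rewrite induced_unit //; apply: (inducedP_left y).1.
  rewrite -(fstar_rnorm (invgK t)) fstarB fstarK in yv.
  rewrite (fstarM _ (invg1 G) (invgK t) _ (mulg1 t)) in yv.
  by rewrite (fstarM _ (invgK t) erefl _ (mulVg t)) !fstarK in yv.
Qed.

End InvariantIdeal.

Lemma invariant_ideal_induced I J :
  invariant_ideal B I -> invariant_ideal B J ->
  (I `<=` J <-> induced B I `<=` induced B J).
Proof.
move=> II JI; split=> [IJ [t y]|IJ].
  by apply: closed_span_mono => _ [i [c [/IJ Ji cT ->]]]; exists i, c.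
rewrite -(induced_unit II.1) -(induced_unit JI.1) => x.
exact: IJ.
Qed.

Section BundleIdeal.
Context (J : set (total B)) (JI : bundle_ideal B J).

Lemma bundle_ideal_mulr s t u (e : (s * t)%g = u) a b :
  set_fiber J s a -> set_fiber J u (fmul B e a b).
Proof.
case: JI => _ JB _ Ja; rewrite -JB set_fiber_of_fibers.
by apply: sub_closed_span; exists s, t, e, a, b.
Qed.

Lemma bundle_ideal_mull s t u (e : (s * t)%g = u) a b :
  set_fiber J t b -> set_fiber J u (fmul B e a b).
Proof.
case: JI => _ _ BJ Jb; rewrite -BJ set_fiber_of_fibers.
by apply: sub_closed_span; exists s, t, e, a, b.
Qed.

Lemma unit_fiber_invariant : invariant_ideal B (set_fiber J 1%g).
Proof.
have [[Jc _ _ _] _ _] := JI.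
split=> [|t].
  by split=> // x b Jx; split; [apply: bundle_ideal_mulr|apply: bundle_ideal_mull].
apply: closed_span_min => // _ [a [i [b [_ Ji _ ->]]]].
exact/bundle_ideal_mulr/bundle_ideal_mull.
Qed.

(** For y in J_t the element y y^* is in J_1, so the factorization of y
    exhibits it as a limit of elements of J_1 B_t. *)
Lemma induced_unit_fiber : induced B (set_fiber J 1%g) = J.
Proof.
have [[Jc _ _ _] _ _] := JI.
apply: total_ext => t; apply/seteqP; split=> [|y Jy].
  by apply: induced_min => // i c Ji; apply: bundle_ideal_mulr.
exact: (factor_induced (bundle_ideal_mulr (mulgV t) (fstar B erefl y) Jy)).
Qed.

End BundleIdeal.

Lemma invariant_ideal_forall (F : set (set (B 1%g))) :
  F `<=` [set I | invariant_ideal B I] ->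
  invariant_ideal B [set x | forall I, F I -> I x].
Proof.
move=> FI; have Fc : closed_subspace [set x | forall I, F I -> I x].
  apply: closed_subspace_forall => I; apply: closed_subspace_forall => FI'.
  by have [[]] := FI _ FI'.
split=> [|t].
  by split=> // x b Fx; split=> I FI'; have [[_ Id] _] := FI _ FI';
    case: (Id x b (Fx _ FI')).
apply: closed_span_min => // _ [a [i [b [_ Fi bS ->]]]] I FI'.
have [_ /(_ t)] := FI _ FI'; apply; apply: sub_closed_span.
by exists a, i, b; split=> //; apply: Fi.
Qed.

(** The join is the intersection of all invariant ideals containing both; this
    avoids proving that sums of closed ideals are closed. *)
Lemma invariant_ideal_lattice : is_lattice [set I | invariant_ideal B I].
Proof.
move=> I J II JI; split.
  exists [set x | forall K, [set I; J] K -> K x]; split.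
  - by apply: invariant_ideal_forall => _ [] ->.
  - by move=> x; apply; left.
  - by move=> x; apply; right.
  - by move=> N _ NI NJ x Nx _ [] ->; [apply: NI|apply: NJ].
exists [set x | forall K, [/\ invariant_ideal B K, I `<=` K & J `<=` K] -> K x].
split.
- by apply: invariant_ideal_forall => K [].
- by move=> x Ix K [_ IK _]; apply: IK.
- by move=> x Jx K [_ _ JK]; apply: JK.
- by move=> N NI IN JN x; apply.
Qed.

End Ideals.

(** * Order isomorphisms between families of sets *)

Section OrderIsomorphism.
Context {T U : Type} (F : set (set T)) (F' : set (set U)) (f : set T -> set U).
Context (f_bij : set_bij F F' f).
Context (f_le : forall X Y, F X -> F Y -> (X `<=` Y <-> f X `<=` f Y)).

Lemma order_iso_meet X Y M : F X -> F Y ->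
  is_meet F X Y M -> is_meet F' (f X) (f Y) (f M).
Proof.
case: f_bij => fF _ fsurj FX FY [FM MX MY Mmax]; split; first exact: fF.
- exact/f_le.
- exact/f_le.
- move=> _ /fsurj[N FN <-] /f_le-/(_ FN FX) NX /f_le-/(_ FN FY) NY.
  by apply/f_le => //; apply: Mmax.
Qed.

Lemma order_iso_join X Y M : F X -> F Y ->
  is_join F X Y M -> is_join F' (f X) (f Y) (f M).
Proof.
case: f_bij => fF _ fsurj FX FY [FM XM YM Mmin]; split; first exact: fF.
- exact/f_le.
- exact/f_le.
- move=> _ /fsurj[N FN <-] /f_le-/(_ FX FN) XN /f_le-/(_ FY FN) YN.
  by apply/f_le => //; apply: Mmin.
Qed.

Lemma order_iso_lattice : is_lattice F -> is_lattice F'.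
Proof.
case: f_bij => fF _ fsurj FL _ _ /fsurj[X FX <-] /fsurj[Y FY <-].
have [[M XYM] [N XYN]] := FL _ _ FX FY.
by split; [exists (f M); apply: order_iso_meet|exists (f N); apply: order_iso_join].
Qed.

End OrderIsomorphism.

(** * The correspondence *)

Theorem proposition3p8 (R : realType) (G : groupType) (B : fell_bundle R G) :
  [/\ is_lattice [set I | invariant_ideal B I],
      is_lattice [set J | bundle_ideal B J],
      lattice_isomorphism [set I | invariant_ideal B I]
        [set J | bundle_ideal B J] (induced B),
      forall I : set (B 1%g), invariant_ideal B I ->
        set_fiber (induced B I) 1%g = I
    & forall J : set (total B), bundle_ideal B J ->
        invariant_ideal B (set_fiber J 1%g) /\
        induced B (set_fiber J 1%g) = J].
Proof.
have unitK I : invariant_ideal B I -> set_fiber (induced B I) 1%g = I.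
  by case=> + _; exact: induced_unit.
have bij : set_bij [set I | invariant_ideal B I] [set J | bundle_ideal B J]
    (induced B).
  split=> [I /induced_ideal //|I J|J JI].
    by rewrite !inE => /unitK IE /unitK JE IJ; rewrite -IE IJ.
  by exists (set_fiber J 1%g); [apply: unit_fiber_invariant|apply: induced_unit_fiber].
have le := @invariant_ideal_induced R G B.
split=> //; first exact: invariant_ideal_lattice.
- exact: order_iso_lattice bij le (@invariant_ideal_lattice R G B).
- by split=> // X Y M; [apply: order_iso_meet|apply: order_iso_join].
- by move=> J JI; split; [apply: unit_fiber_invariant|apply: induced_unit_fiber].
Qed.
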